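(* Let $T$ be a tree and $u$ a vertex of $T$ with $u\in\mathcal{N}_T$. Suppose $u$ is adjacent to exactly $p$ vertices that are isolated vertices of the induced subgraph $T[\mathcal{A}_T]$ and to exactly $q$ vertices that are end-vertices of isolated edges of $T[\mathcal{A}_T]$ (edges forming a connected component of $T[\mathcal{A}_T]$). Then $p+2q\geq 4$ or $p=3$. Consequently, if $\mathcal{N}_T\neq\emptyset$, then $|\mathcal{A}_T|\geq 3$.
   Context: A dissociation set of a graph $G$ is a set $S$ of vertices such that $G[S]$ has maximum degree at most $1$; a maximum dissociation set is one of maximum cardinality. $\mathcal{A}_T$ denotes the set of vertices of $T$ that belong to every maximum dissociation set of $T$, and $\mathcal{N}_T$ denotes the set of vertices of $T$ that belong to no maximum dissociation set of $T$. *)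

(* Defs.v *)
From mathcomp Require Import all_boot.

Set Implicit Arguments.
Unset Strict Implicit.
Unset Printing Implicit Defensive.

(* A graph with (finite) vertex type V is given by its adjacency relation. *)

Section Graphs.
Variables (V : finType) (e : rel V).

Definition simple_graph : Prop := symmetric e /\ irreflexive e.

Definition connected_graph : Prop := 0 < #|V| /\ forall x y, connect e x y.

(* Since [e] is symmetric, an edge traversed back and forth is a [ucycle] of
   size 2; genuine cycles are those with at least three vertices. *)
Definition acyclic_graph : Prop :=
  forall c : seq V, ucycle e c -> size c < 3.

Definition tree : Prop :=
  [/\ simple_graph, connected_graph & acyclic_graph].

Implicit Types (S : {set V}) (u v w : V).

(* Adjacency in the subgraph induced by S; vertices outside S, which remain in
   the type V, have no neighbor. *)
Definition induced S : rel V := [rel v w | [&& v \in S, w \in S & e v w]].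

Definition induced_degree S v : nat := #|[set w | induced S v w]|.

Definition dissociation S : bool := [forall v in S, induced_degree S v <= 1].

Definition max_dissociation S : bool :=
  dissociation S && [forall S' : {set V}, dissociation S' ==> (#|S'| <= #|S|)].

Definition in_all_max : {set V} :=
  [set v | [forall S : {set V}, max_dissociation S ==> (v \in S)]].

Definition in_no_max : {set V} :=
  [set v | [forall S : {set V}, max_dissociation S ==> (v \notin S)]].

Definition isolated_vertex S v : bool :=
  (v \in S) && (induced_degree S v == 0).

Definition component S v : {set V} := [set w | connect (induced S) v w].

Definition isolated_edge_end S v : bool :=
  [exists w, induced S v w && (component S v == [set v; w])].

End Graphs.

(* Main.v *)
Require Import Defs.
From mathcomp Require Import all_boot.
From mathcomp Require Import zify.

Set Implicit Arguments.
Unset Strict Implicit.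
Unset Printing Implicit Defensive.

(** Write A for the vertices lying in every maximum dissociation set. As A is
    contained in a dissociation set, every neighbour of u in A is an isolated
    vertex or an end of an isolated edge of T[A]. Inside one branch of T - u,
    maximum sets (which all avoid u) can be exchanged freely, so some maximum
    set meets N(u) only in A. If u had at most one neighbour in A, exchanging
    that neighbour for u would give a maximum set containing u. If u has exactly
    two neighbours v, v' in A and v is isolated in some maximum set,
    exchanging v' for u (now matched to v) is again a contradiction; so v is
    matched in every maximum set, and another exchange argument, on branches of
    T - v, shows that its partner is then always the same, hence lies in A. *)

(** * Maximum dissociation sets in a graph *)

Section Dissociation.
Variables (V : finType) (e : rel V).
Hypothesis (symE : symmetric e).
Implicit Types (S B : {set V}) (u v w x : V).

Lemma inducedE S x y : induced e S x y = [&& x \in S, y \in S & e x y].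
Proof. by []. Qed.

Lemma dissociationP S :
  reflect {in S & &, forall x y z, e x y -> e x z -> y = z} (dissociation e S).
Proof.
apply: (iffP forall_inP) => [dS x y z xS yS zS exy exz | dS x xS].
  by apply: (card_le1_eqP (dS x xS)); rewrite inE; apply/and3P.
apply/card_le1_eqP => y z; rewrite !inE !inducedE xS /= => /andP[yS exy] /andP[zS exz].
exact: (dS x).
Qed.

Lemma dissociation_sub S B : B \subset S -> dissociation e S -> dissociation e B.
Proof.
move=> /subsetP sBS /dissociationP dS; apply/dissociationP => x y z xB yB zB.
by apply: dS; apply: sBS.
Qed.

Lemma max_dissociation_le S B :
  max_dissociation e S -> dissociation e B -> #|B| <= #|S|.
Proof. by case/andP=> _ /forallP/(_ B)/implyP. Qed.

Lemma max_dissociation_card S B : max_dissociation e S -> dissociation e B ->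
  #|S| <= #|B| -> max_dissociation e B.
Proof.
move=> mS dB leSB; apply/andP; split=> //; apply/forallP => C; apply/implyP => dC.
exact: leq_trans (max_dissociation_le mS dC) leSB.
Qed.

Lemma max_dissociation_ex : exists S, max_dissociation e S.
Proof.
have d0 : dissociation e set0 by apply/forall_inP => x; rewrite inE.
case: (arg_maxnP (fun S => #|S|) d0) => S dS maxS.
by exists S; apply/andP; split=> //; apply/forallP => C; apply/implyP/maxS.
Qed.

Lemma in_all_maxP v :
  reflect (forall S, max_dissociation e S -> v \in S) (v \in in_all_max e).
Proof.
rewrite inE; apply: (iffP forallP) => H S; first exact/implyP.
exact/implyP/H.
Qed.

Lemma notin_all_max v :
  v \notin in_all_max e -> exists2 S, max_dissociation e S & v \notin S.
Proof.
by rewrite inE negb_forall => /existsP[S]; rewrite negb_imply => /andP[]; exists S.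
Qed.

Lemma in_no_max_notin u S :
  u \in in_no_max e -> max_dissociation e S -> u \notin S.
Proof. by rewrite inE => /forallP/(_ S)/implyP. Qed.

Lemma dissociation_in_all_max : dissociation e (in_all_max e).
Proof.
have [S mS] := max_dissociation_ex.
apply: dissociation_sub (proj1 (andP mS)).
by apply/subsetP => v /in_all_maxP; apply.
Qed.

(** * Exchanging and extending dissociation sets *)

Definition mix B S S' : {set V} := (S :&: B) :|: (S' :\: B).

Lemma in_mix B S S' x :
  (x \in mix B S S') = if x \in B then x \in S else x \in S'.
Proof. by rewrite !inE; case: (x \in B); rewrite /= ?andbT ?andbF ?orbF. Qed.

Lemma card_mix B S S' : #|mix B S S'| = #|S :&: B| + #|S' :\: B|.
Proof.
rewrite cardsU setIDA; suff -> : S :&: B :&: S' :\: B = set0 by rewrite cards0 subn0.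
by apply/setP => x; rewrite !inE; case: (x \in B); rewrite /= ?andbF.
Qed.

Lemma dissociation_mix B S S' : dissociation e S -> dissociation e S' ->
  {in S :&: B & S' :\: B, forall x y, ~~ e x y} -> dissociation e (mix B S S').
Proof.
move=> /dissociationP dS /dissociationP dS' noE.
(* No edge inside the mixed set crosses the boundary of [B], so a vertex and its neighbours all come
   from [S] or all from [S']. *)
have side x y : x \in mix B S S' -> y \in mix B S S' -> e x y ->
    (y \in B) = (x \in B).
  rewrite !in_mix => xm ym exy; case: ifP ym => yB ym; case: ifP xm => xB xm //.
    suff /negP[] : ~~ e y x by rewrite symE.
    by apply: noE; rewrite !inE ?yB ?xB ?ym ?xm.
  suff /negP[] : ~~ e x y by [].
  by apply: noE; rewrite !inE ?yB ?xB ?ym ?xm.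
apply/dissociationP => x y z xm ym zm exy exz.
have yx := side _ _ xm ym exy; have zx := side _ _ xm zm exz.
move: xm ym zm; rewrite !in_mix yx zx; case: ifP => _ xm ym zm.
  exact: (dS x).
exact: (dS' x).
Qed.

(** The two mixes together have as many vertices as [S] and [S'] together, so neither can fall below
    the maximum without the other exceeding it. *)
Lemma max_mix B S S' : max_dissociation e S -> max_dissociation e S' ->
  dissociation e (mix B S S') -> dissociation e (mix B S' S) ->
  max_dissociation e (mix B S S').
Proof.
move=> mS mS' d d'; apply: (max_dissociation_card mS) => //.
have := max_dissociation_le mS' d'; rewrite !card_mix.
by have := cardsID B S; have := cardsID B S'; lia.
Qed.

Lemma dissociation_add_isolated u S : irreflexive e -> dissociation e S ->
  {in S, forall v, ~~ e u v} -> dissociation e (u |: S).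
Proof.
move=> irrE /dissociationP dS nu.
apply/dissociationP => x y z /setU1P[->|xS] /setU1P[->|yS] /setU1P[->|zS];
  rewrite ?irrE ?[e x u]symE ?(negPf (nu _ xS)) ?(negPf (nu _ yS))
    ?(negPf (nu _ zS)) //.
exact: dS.
Qed.

Lemma dissociation_add_edge u v S : irreflexive e -> dissociation e S ->
  {in S, forall w, e u w -> w = v} -> {in S, forall w, ~~ e v w} ->
  dissociation e (u |: S).
Proof.
move=> irrE /dissociationP dS nu nv.
apply/dissociationP => x y z /setU1P[->|xS] /setU1P[->|yS] /setU1P[->|zS] //;
  rewrite ?irrE // ?[e x u]symE => exy exz.
- by rewrite (nu _ yS exy) (nu _ zS exz).
- by move: (nv _ zS); rewrite -(nu _ xS exy) exz.
- by move: (nv _ yS); rewrite -(nu _ xS exz) exy.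
exact: (dS x).
Qed.

(** As A is a dissociation set, [v] and [w] have no further neighbours in A, so [[set v; w]] is
    closed under adjacency in T[A]. *)
Lemma isolated_edge_end_intro v w : v \in in_all_max e -> w \in in_all_max e ->
  e v w -> isolated_edge_end e (in_all_max e) v.
Proof.
move=> vA wA evw; apply/existsP; exists w; rewrite inducedE vA wA evw /=.
have /dissociationP dA := dissociation_in_all_max.
apply/eqP/setP => z; rewrite !inE; apply/idP/idP; last first.
  by case/orP=> /eqP->; [apply: connect0 | apply: connect1; rewrite inducedE vA wA].
suff cl : closed (induced e (in_all_max e)) (mem [set v; w]).
  by move/(closed_connect cl); rewrite !inE eqxx /= => <-.
apply: intro_closed => [|x y].
  by apply: sym_connect_sym => x y; rewrite !inducedE symE andbCA.
case/and3P=> xA yA exy; rewrite !inE => /orP[]/eqP xE; move: exy; rewrite xE => exy.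
  by rewrite (dA v y w) // eqxx orbT.
by rewrite (dA w y v) ?eqxx // symE.
Qed.

Lemma isolated_or_edge_end v : v \in in_all_max e ->
  isolated_vertex e (in_all_max e) v || isolated_edge_end e (in_all_max e) v.
Proof.
move=> vA; rewrite /isolated_vertex vA /= /induced_degree cards_eq0.
case: (set_0Vmem [set w | induced e (in_all_max e) v w]) => [->|[w]].
  by rewrite eqxx.
rewrite inE => /and3P[_ wA evw].
by rewrite (isolated_edge_end_intro vA wA evw) orbT.
Qed.

End Dissociation.

(** * Branches of a tree at a vertex *)

Section Tree.
Variables (V : finType) (e : rel V).
Hypothesis (treeT : tree e).
Implicit Types (S B : {set V}) (u v w x : V).

Let symE : symmetric e. Proof. by case: treeT => [[]]. Qed.
Let irrE : irreflexive e. Proof. by case: treeT => [[]]. Qed.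

(** For [v] adjacent to [x], this is the component of T - x hanging at [v]. As [x] stays in the
    type, [branch x x] is the singleton of [x]. *)
Definition branch x v : {set V} := component e (~: [set x]) v.

Lemma branch_refl x v : v \in branch x v.
Proof. by rewrite inE connect0. Qed.

Lemma branch_sym x v w : (w \in branch x v) = (v \in branch x w).
Proof.
rewrite !inE; apply: sym_connect_sym => a b.
by rewrite !inducedE symE andbCA.
Qed.

Lemma branch_notin x v : v != x -> x \notin branch x v.
Proof.
move=> vx; rewrite branch_sym inE; apply/negP => /connectP[[|a p] /=].
  by move=> _ vE; rewrite vE eqxx in vx.
by rewrite inducedE !inE eqxx.
Qed.

Lemma branch_edge x v a b :
  v != x -> a \in branch x v -> b \notin branch x v -> e a b -> b = x.
Proof.
move=> vx aB bB eab; apply/eqP; apply: contraNT bB => bx.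
have ax : a != x by apply: contraNneq (branch_notin vx) => ax; rewrite -{1}ax.
move: aB; rewrite !inE => aB; apply: connect_trans aB (connect1 _).
by rewrite inducedE !inE ax bx.
Qed.

Lemma adjacent_neq x v : e x v -> v != x.
Proof. by apply: contraTneq => ->; rewrite irrE. Qed.

(** Otherwise a simple path from [v] to [w] avoiding [x] would close up through [x] to a cycle on at
    least three vertices. *)
Lemma branch_adjacent x v w : e x v -> e x w -> w \in branch x v -> w = v.
Proof.
move=> exv exw; rewrite inE => /connectP[p0 pth0 wE].
case: (shortenP pth0) wE => p pth uq _ wE.
have sub : path e v p.
  by apply: sub_path pth => a b /and3P[].
have xp : x \notin v :: p.
  rewrite inE eq_sym negb_or adjacent_neq //=.
  elim: p v pth {exv pth0 uq wE sub} => //= a p IH v /andP[/and3P[_ ax _] pth].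
  rewrite !inE eq_sym in ax *; rewrite negb_or ax; exact: IH pth.
case: treeT => _ _ /(_ (x :: v :: p)); case: p => [|a p] in wE sub xp uq pth *.
  by [].
suff cyc : ucycle e [:: x, v, a & p] by move=> /(_ cyc).
rewrite /ucycle /cycle cons_uniq xp uq andbT rcons_path.
by move: wE sub => /= <- ->; rewrite exv symE exw.
Qed.

Lemma branch_disjoint x v w : e x v -> e x w -> v != w ->
  [disjoint branch x v & branch x w].
Proof.
move=> exv exw; apply: contra_neqT => /pred0Pn[a /andP[/= av aw]].
apply/esym/(branch_adjacent exv exw).
move: av aw; rewrite [_ \in branch x w]branch_sym !inE; exact: connect_trans.
Qed.

(** The only edge leaving the branch joins [v] to [x], and the last hypothesis keeps one of these
    ends out of the mix. *)
Lemma mix_branch x v S S' : e x v -> dissociation e S -> dissociation e S' ->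
  (v \notin S) || (x \notin S') -> dissociation e (mix (branch x v) S S').
Proof.
move=> exv dS dS' nvx; apply: dissociation_mix => // a b.
case/setIP=> aS aB /setDP[bS' bB]; apply: contraL nvx => eab.
have bx := branch_edge (adjacent_neq exv) aB bB eab.
rewrite {}bx in bS' eab *; rewrite negb_or !negbK bS' andbT.
by rewrite -(branch_adjacent exv _ aB) // symE.
Qed.

(** * Exchange arguments on branches *)

Lemma in_all_max_partner v : v \in in_all_max e ->
  (forall S, max_dissociation e S -> exists2 w, w \in S & e v w) ->
  exists2 w, w \in in_all_max e & e v w.
Proof.
move=> /in_all_maxP vA matched.
have [S' mS'] := max_dissociation_ex e; have [w wS' evw] := matched _ mS'.
exists w => //; apply/negPn/negP => /notin_all_max[S mS wS].
have [[dS _] [dS' _]] := (andP mS, andP mS').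
pose B := branch v w.
(* Otherwise using [S] on the branch loses nothing, yet leaves [v] unmatched: [w] is gone, and [S']
   has no second neighbour of [v]. *)
have card_lt : #|S :&: B| < #|S' :&: B|.
  have d : dissociation e (mix B S S') by apply: mix_branch; rewrite ?wS.
  rewrite ltnNge; apply/negP => le_card.
  have m : max_dissociation e (mix B S S').
    apply: max_dissociation_card mS' d _; rewrite card_mix -(cardsID B S').
    by rewrite leq_add2r.
  have [z] := matched _ m; rewrite in_mix; case: ifP => [zB zS|zB zS'] evz.
    by rewrite -(branch_adjacent evw evz zB) zS in wS.
  have zw : z = w by move/dissociationP: dS' => /(_ v z w); apply; rewrite ?vA.
  by rewrite zw branch_refl in zB.
(* The vertex gained on the branch pays for deleting [v], which yields a maximum set without [v]. *)
have d : dissociation e (mix B S' (S :\ v)).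
  apply: mix_branch => //; last by rewrite !inE eqxx orbT.
  by apply: dissociation_sub dS; apply: subD1set.
have m : max_dissociation e (mix B S' (S :\ v)).
  apply: max_dissociation_card mS d _; rewrite card_mix.
  have -> : S :\ v :\: B = (S :\: B) :\ v by rewrite !setDDl setUC.
  have := cardsID B S; have := cardsD1 v (S :\: B).
  by case: (v \in _) => /=; lia.
have := vA _ m; rewrite in_mix (negPf (branch_notin (adjacent_neq evw))).
by rewrite !inE eqxx.
Qed.

(** [C] is a region protected from the exchanges; it serves to preserve the neighbourhood of a
    chosen vertex. Take a set with fewest neighbours of [u] outside A among the maximum sets
    agreeing with [S] on [C]. *)
Lemma max_dissociation_normalize u S (C : {set V}) :
  u \in in_no_max e -> max_dissociation e S ->
  (forall w, w \notin in_all_max e -> e u w -> [disjoint branch u w & C]) ->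
  exists S', [/\ max_dissociation e S', {in C, S' =i S} &
    {in S', forall w, e u w -> w \in in_all_max e}].
Proof.
move=> uN mS disjC.
pose good S' := max_dissociation e S' && (S' :&: C == S :&: C).
have gS : good S by rewrite /good mS eqxx.
pose bad S' := #|[set w in S' | e u w & w \notin in_all_max e]|.
case: (arg_minnP bad gS) => S1 /andP[mS1 /eqP S1C] minS1; exists S1; split=> //.
  by move=> z zC; move/setP/(_ z): S1C; rewrite !inE zC !andbT.
move=> w wS1 euw; apply/negPn/negP => wA.
have [S2 mS2 wS2] := notin_all_max wA.
have [[d1 _] [d2 _]] := (andP mS1, andP mS2).
have [u1 u2] := (in_no_max_notin uN mS1, in_no_max_notin uN mS2).
pose B := branch u w.
have m : max_dissociation e (mix B S2 S1).
  by apply: max_mix => //; apply: mix_branch; rewrite ?u1 ?u2 ?orbT.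
have g : good (mix B S2 S1).
  rewrite /good m -S1C; apply/eqP/setP => z; rewrite !in_setI in_mix.
  case: ifP => // zB; have := disjC _ wA euw.
  by move=> /pred0P/(_ z); rewrite /= zB => /= ->; rewrite !andbF.
(* The exchange drops [w] and brings in no new neighbour of [u], since [w] is the only one in its
   branch. *)
have := minS1 _ g; rewrite leqNgt => /negP[]; apply: proper_card.
apply/properP; split; last first.
  by exists w; rewrite inE ?wS1 ?euw ?wA // in_mix branch_refl (negPf wS2).
apply/subsetP => z; rewrite inE => /and3P[]; rewrite in_mix.
case: ifP => [zB zS2 euz _|_ zS1 euz zA]; last by rewrite inE zS1 euz.
by rewrite -(branch_adjacent euw euz zB) zS2 in wS2.
Qed.

(** * Neighbours in A of a vertex lying in no maximum set *)

Lemma in_no_max_neighbors u : u \in in_no_max e ->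
  2 <= #|[set v in in_all_max e | e u v]|.
Proof.
move=> uN; rewrite leqNgt ltnS; apply/negP => le1.
set K := [set _ in _ | _] in le1.
have [S0 mS0] := max_dissociation_ex e.
have [|S [mS _ SA]] := max_dissociation_normalize (C := set0) uN mS0.
  by move=> w _ _; rewrite disjoint_sym disjoints_subset sub0set.
have uS := in_no_max_notin uN mS; have [dS _] := andP mS.
have d : dissociation e (u |: (S :\: K)).
  apply: dissociation_add_isolated => //.
    by apply: dissociation_sub dS; apply: subsetDl.
  move=> v /setDP[vS]; rewrite inE negb_and => vK; apply/negP => euv.
  by rewrite SA ?euv in vK.
have m : max_dissociation e (u |: (S :\: K)).
  apply: max_dissociation_card mS d _.
  rewrite cardsU1 inE (negPf uS) andbF -(cardsID K S).
  by have := subset_leq_card (subsetIr S K); lia.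
by have := in_no_max_notin uN m; rewrite setU11.
Qed.

Lemma in_no_max_two_neighbors u v S : u \in in_no_max e ->
  #|[set v in in_all_max e | e u v]| = 2 ->
  v \in in_all_max e -> e u v -> max_dissociation e S ->
  exists2 w, w \in S & e v w.
Proof.
set K := [set _ in _ | _] => uN K2 vA euv mS.
apply/exists_inP; apply: contraT => /exists_inPn isoS.
(* All neighbours of [v] except [u] lie in this branch, so protecting it keeps [v] without
   neighbours in [S1]. *)
have [|S1 [mS1 S1S S1A]] := max_dissociation_normalize (C := branch u v) uN mS.
  by move=> w wA euw; apply: branch_disjoint => //; apply: contraNneq wA => ->.
have uS1 := in_no_max_notin uN mS1; have [dS1 _] := andP mS1.
have vK : v \in K by rewrite inE vA.
(* Only one vertex is removed, so adding [u] restores the size. *)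
pose S2 := S1 :\: (K :\ v).
have d2 : dissociation e S2 by apply: dissociation_sub dS1; apply: subsetDl.
have d : dissociation e (u |: S2).
  apply: (@dissociation_add_edge _ _ symE u v) => //.
    move=> w /setDP[wS1 wK] euw; apply: contraNeq wK => wv.
    by rewrite in_setD1 wv inE euw andbT (S1A w).
  move=> w /setDP[wS1 _]; apply/negP => evw.
  have wB : w \in branch u v.
    apply: contraNT uS1 => wB.
    by rewrite -(branch_edge (adjacent_neq euv) (branch_refl u v) wB evw).
  by move: (isoS w); rewrite -S1S // wS1 evw => /(_ isT).
have m : max_dissociation e (u |: S2).
  apply: max_dissociation_card mS1 d _.
  rewrite cardsU1 inE (negPf uS1) andbF -(cardsID (K :\ v) S1).
  have := subset_leq_card (subsetIr S1 (K :\ v)).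
  by have := cardsD1 v K; rewrite vK K2 /S2; lia.
by have := in_no_max_notin uN m; rewrite setU11.
Qed.

Lemma in_no_max_two_partner u v : u \in in_no_max e ->
  #|[set v in in_all_max e | e u v]| = 2 ->
  v \in in_all_max e -> e u v -> exists2 w, w \in in_all_max e & e v w.
Proof.
move=> uN K2 vA euv; apply: in_all_max_partner => // S.
exact: in_no_max_two_neighbors K2 vA euv.
Qed.

End Tree.

(** * Counting the neighbours and the vertices of A *)

Theorem theorem3p8 (V : finType) (e : rel V) (treeT : tree e) :
  (forall (u : V) (p q : nat),
     u \in in_no_max e ->
     p = #|[set v | e u v & isolated_vertex e (in_all_max e) v]| ->
     q = #|[set v | e u v & isolated_edge_end e (in_all_max e) v]| ->
     4 <= p + 2 * q \/ p = 3) /\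
  (in_no_max e != set0 -> 3 <= #|in_all_max e|).
Proof.
have [[symE irrE] _ _] := treeT.
split=> [u p q uN pE qE | /set0Pn[u uN]].
  have K2 := in_no_max_neighbors treeT uN.
  have sub : [set v in in_all_max e | e u v] \subset
      [set v | e u v & isolated_vertex e (in_all_max e) v] :|:
      [set v | e u v & isolated_edge_end e (in_all_max e) v].
    apply/subsetP => v; rewrite inE => /andP[vA euv].
    rewrite in_setU [v \in finset _]inE [X in _ || X]inE euv.
    exact: isolated_or_edge_end.
  have le_pq := leq_trans (subset_leq_card sub) (leq_card_setU _ _).
  rewrite -pE -qE in le_pq.
  (* With three or more neighbours in A, p + q is at least 3: either q = 0 and p is at least 3, or p
     + 2q is at least 4. *)
  have [|K2E] := boolP (#|[set v in in_all_max e | e u v]| != 2); first by lia.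
  move/negPn/eqP in K2E.
  have : #|[set v in in_all_max e | e u v]| <= q.
    rewrite qE; apply/subset_leq_card/subsetP => v; rewrite inE => /andP[vA euv].
    have [w wA evw] := in_no_max_two_partner treeT uN K2E vA euv.
    by rewrite inE euv (isolated_edge_end_intro symE vA wA evw).
  by lia.
have := in_no_max_neighbors treeT uN.
have [K2E _|] := eqVneq #|[set v in in_all_max e | e u v]| 2; last first.
  have : #|[set v in in_all_max e | e u v]| <= #|in_all_max e|.
    by apply/subset_leq_card/subsetP => v; rewrite inE => /andP[].
  by lia.
have /card_gt0P[v] : 0 < #|[set v in in_all_max e | e u v]| by rewrite K2E.
rewrite inE => /andP[vA euv].
have [w wA evw] := in_no_max_two_partner treeT uN K2E vA euv.
(* The partner [w] is a third vertex of A: were it adjacent to [u], then [u], [v], [w] would form a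
   triangle. *)
rewrite -K2E; apply: proper_card; apply/properP; split.
  by apply/subsetP => z; rewrite inE => /andP[].
exists w => //; rewrite inE wA; apply: contraTN evw => euw.
have uw := branch_edge treeT (adjacent_neq treeT euv) (branch_refl e _ _).
apply/negP => evw; have [wB|wB] := boolP (w \in branch e u v).
  by rewrite (branch_adjacent treeT euv euw wB) irrE in evw.
by rewrite (uw _ wB evw) irrE in euw.
Qed.
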